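(* (1) For $n=9$, both trees $A_9$ and $B_9$ maximize the Wiener index in $\mathfrak{T}_9(5)$, i.e. $W(A_9)=W(B_9)=\max\{W(T):T\in\mathfrak{T}_9(5)\}$. (2) If $n\geq 10$, then $A_n$ uniquely (up to isomorphism) maximizes the Wiener index in $\mathfrak{T}_n(n-4)$.
   Context: All graphs are finite, connected, undirected, without loops or parallel edges. The Wiener index $W(G)$ of a graph $G$ is the sum of the distances between all unordered pairs of vertices of $G$. $\mathfrak{T}_n(d)$ denotes the family of all trees on $n$ vertices with diameter $d$. For $n\ge 9$, let $P: v_0v_1\cdots v_{n-4}$ be a path on $n-3$ vertices. $A_n$ is the tree on $n$ vertices obtained from $P$ by attaching one new pendant vertex to $v_1$ and two new pendant vertices to $v_{n-5}$. $B_n$ is the tree on $n$ vertices obtained from $P$ by attaching one new pendant vertex to $v_{n-5}$ and by adding two new vertices $x,y$ with edges $v_2x$ and $xy$. *)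

(* Defs.v *)
From mathcomp Require Import all_boot.

Set Implicit Arguments.
Unset Strict Implicit.
Unset Printing Implicit Defensive.

Section Graphs.

Variables (T : finType) (e : rel T).

Definition simple_graph : Prop := symmetric e /\ irreflexive e.

Definition connected_graph : Prop := forall x y : T, connect e x y.

(* A simple cycle of a graph has at least three vertices; the [ucycle]s of size
   at most two are the empty sequence and single edges traversed back and
   forth. *)
Definition acyclic_graph : Prop := forall c : seq T, ucycle e c -> size c <= 2.

Definition is_tree : Prop :=
  [/\ simple_graph, connected_graph & acyclic_graph].

(* The least length of a walk from x to y. A shortest walk repeats no vertex,
   so only lengths below #|T| are tried; the value is #|T| if y is not
   reachable from x. *)
Definition gdist (x y : T) : nat :=
  find (fun k => [exists p : k.-tuple T, path e x p && (last x p == y)])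
       (iota 0 #|T|).

Definition diameter : nat := \max_(x : T) \max_(y : T) gdist x y.

(* Comparing ranks selects each unordered pair of distinct vertices once. *)
Definition wiener : nat :=
  \sum_(x : T) \sum_(y : T | enum_rank x < enum_rank y) gdist x y.

Definition in_Tfamily (n d : nat) : Prop :=
  [/\ #|T| = n, is_tree & diameter = d].

End Graphs.

Definition graph_iso (T U : finType) (e : rel T) (e' : rel U) : Prop :=
  exists2 f : T -> U, bijective f & forall x y, e' (f x) (f y) = e x y.

Definition maximizes_wiener (n d : nat) (T : finType) (e : rel T) : Prop :=
  in_Tfamily e n d /\
  forall (U : finType) (e' : rel U), in_Tfamily e' n d -> wiener e' <= wiener e.

(* The graph on {0, ..., n-1} consisting of the path 0, 1, ..., n-4 and the
   edges listed in [extra]; the labels n-3, n-2, n-1 are the vertices off the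
   path. *)
Definition path_plus (n : nat) (extra : seq (nat * nat)) : rel 'I_n :=
  let arc (i j : nat) :=
    (j == i.+1) && (j <= n - 4) || ((i, j) \in extra) in
  fun i j => arc i j || arc j i.

Definition A_tree (n : nat) : rel 'I_n :=
  path_plus [:: (1, n - 3); (n - 5, n - 2); (n - 5, n - 1)].

(* x and y are labelled n-2 and n-1. *)
Definition B_tree (n : nat) : rel 'I_n :=
  path_plus [:: (n - 5, n - 3); (2, n - 2); (n - 2, n - 1)].

Arguments A_tree : clear implicits.
Arguments B_tree : clear implicits.

(* Main.v *)
(* Let v_0 ... v_d be a diametral path of a tree on d + 4 vertices and a, b, c
   the three vertices off it. Each of them hangs at some height h above some
   position p of the path, with h <= p and h <= d - p because d is the diameter,
   and its distances to the path add up to d(d+1)/2 - p(d-p) + (d+1)h. The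
   mutual distances of a, b, c are at most h + h' + |p - p'|, and a vertex of
   height at least 2 has a neighbour among the other two, at the same position
   and one level lower. So the Wiener index is bounded by a function of a few
   integers, which is largest when all heights are 1 and the positions are
   1, d - 1, d - 1 (up to symmetry), and only then if d >= 6. In the case of
   equality all distances are those of A_n, hence so are the edges. *)

Require Import Defs.
From mathcomp Require Import all_boot zify.

Set Implicit Arguments.
Unset Strict Implicit.
Unset Printing Implicit Defensive.

(** * Distances in connected graphs and trees *)

Section Distance.

Variables (T : finType) (e : rel T).
Hypotheses (e_sym : symmetric e) (e_conn : connected_graph e).

Local Notation dist := (gdist e).

Lemma gdist_le_size x p : path e x p -> dist x (last x p) <= size p.
Proof.
move=> ep; rewrite /gdist.
set P := (X in find X _).
have Pp : P (size p) by apply/existsP; exists (in_tuple p); rewrite /= ep eqxx.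
(* For a long walk the bound holds by default: [find] never exceeds the length [#|T|] of the list
   searched. *)
have [lt_p|ge_p] := ltnP (size p) #|T|; last first.
  by apply: leq_trans ge_p; rewrite -[X in _ <= X](size_iota 0) find_size.
rewrite leqNgt; apply/negP=> /(before_find 0).
by rewrite nth_iota // add0n Pp.
Qed.

Lemma gdist_path x y :
  exists p, [/\ path e x p, last x p = y & size p = dist x y].
Proof.
have /connectP[p0 ep0 ->] := e_conn x y.
(* A walk without repeated vertices has length below [#|T|], so the search succeeds. *)
case/shortenP: ep0 => p ep Up _ {p0}; set z := last x p.
rewrite /gdist; set P := (X in find X _).
have hasP : has P (iota 0 #|T|).
  apply/hasP; exists (size p).
    rewrite mem_iota /= add0n; have := card_uniqP Up.
    by have := max_card (mem (x :: p)) => /= + <-.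
  by apply/existsP; exists (in_tuple p); rewrite /= ep eqxx.
have := nth_find 0 hasP; move: hasP; rewrite has_find size_iota => lt_f.
rewrite nth_iota // add0n => /existsP[q /andP[eq /eqP lq]].
by exists q; split=> //; rewrite size_tuple.
Qed.

Lemma gdist0 x : dist x x = 0.
Proof. by apply/eqP; rewrite -leqn0 (@gdist_le_size x [::]). Qed.

Lemma gdist_eq0 x y : (dist x y == 0) = (x == y).
Proof.
apply/eqP/eqP=> [d0|->]; last exact: gdist0.
by have [p [_]] := gdist_path x y; rewrite d0 => <- /size0nil ->.
Qed.

Lemma gdist_triangle y x z : dist x z <= dist x y + dist y z.
Proof.
have [p [ep lp <-]] := gdist_path x y; have [q [eq lq <-]] := gdist_path y z.
rewrite -size_cat -lq -lp -last_cat gdist_le_size //.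
by rewrite cat_path ep lp.
Qed.

Lemma gdist_sym x y : dist x y = dist y x.
Proof.
suff le_d a b : dist a b <= dist b a by apply/eqP; rewrite eqn_leq !le_d.
have [p [ep <- <-]] := gdist_path b a.
have := @gdist_le_size (last b p) (rev (belast b p)).
rewrite rev_path (eq_path (e' := e)); last by move=> u v; rewrite e_sym.
rewrite size_rev size_belast => /(_ ep).
by case: p {ep} => //= c p; rewrite rev_cons last_rcons.
Qed.

Lemma edge_gdist x y : irreflexive e -> e x y = (dist x y == 1).
Proof.
move=> e_irr; apply/idP/eqP=> [exy|d1].
  apply/eqP; rewrite eqn_leq lt0n gdist_eq0 (@gdist_le_size x [:: y]) /= ?exy //.
  by apply: contraL exy => /eqP->; rewrite e_irr.
have [p []] := gdist_path x y; rewrite d1.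
by case: p => [|z []] //= /andP[exz _] <-.
Qed.

Lemma gdist_edge_le x y : e x y -> dist x y <= 1.
Proof. by move=> exy; rewrite (@gdist_le_size x [:: y]) //= exy. Qed.

Lemma gdist_step x z : x != z ->
  exists2 y, e x y & dist x z = (dist y z).+1.
Proof.
have [p [+ + dp]] := gdist_path x z.
case: p dp => [|y p] /= dp; first by move=> _ -> /eqP.
case/andP=> exy ep lp _; exists y => //.
apply/eqP; rewrite eqn_leq; apply/andP; split.
  by apply: leq_trans (gdist_triangle y _ _) _; rewrite -add1n leq_add2r gdist_edge_le.
by rewrite -dp ltnS -lp gdist_le_size.
Qed.

(** A shortest path between two vertices at maximal distance works: a shortcut between two of its
    vertices would bring its ends closer than the diameter. With truncated subtraction,
    [(i - j) + (j - i)] is the absolute difference. *)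
Lemma diameter_geodesic : 0 < #|T| ->
  exists v : nat -> T, [/\ forall i, i < diameter e -> e (v i) (v i.+1)
   & forall i j, i <= diameter e -> j <= diameter e ->
       dist (v i) (v j) = (i - j) + (j - i)].
Proof.
move=> T_gt0; have [x0 _] : exists x0 : T, x0 \in T by apply/card_gt0P.
have [x dx] := eq_bigmax (fun x => \max_(y : T) dist x y) T_gt0.
have [y dy] := eq_bigmax (dist x) T_gt0.
have {dx dy} dxy : diameter e = dist x y by rewrite -dy -dx.
have [p [ep lp sp]] := gdist_path x y.
set d := diameter e in dxy *; rewrite -dxy in sp.
pose v i := nth x (x :: p) i.
have ev i : i < d -> e (v i) (v i.+1).
  by rewrite -sp => lt_i; have /pathP := ep; apply.
have vle i k : i + k <= d -> dist (v i) (v (i + k)) <= k.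
  elim: k => [|k IHk] le_d; first by rewrite addn0 gdist0.
  rewrite addnS in le_d *; apply: leq_trans (gdist_triangle (v (i + k)) _ _) _.
  by rewrite -[k.+1]addn1; apply: leq_add; [apply/IHk/ltnW | apply/gdist_edge_le/ev].
have vE i k : i + k <= d -> dist (v i) (v (i + k)) = k.
  move=> le_d; apply/eqP; rewrite eqn_leq vle //=.
  have := gdist_triangle (v i) x y.
  have := gdist_triangle (v (i + k)) (v i) y; rewrite -dxy.
  have vd : v d = y by rewrite /v -sp nth_last.
  have v0i : dist x (v i) <= i by rewrite (@vle 0 i) //; lia.
  have : dist (v (i + k)) y <= d - (i + k).
    by have := @vle (i + k) (d - (i + k)); rewrite subnKC // vd => ->.
  lia.
exists v; split=> // i j le_i le_j.
have [le_ij|/ltnW le_ji] := leqP i j.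
  by have := @vE i (j - i); rewrite subnKC // => -> //; lia.
by have := @vE j (i - j); rewrite subnKC // gdist_sym => -> //; lia.
Qed.

(* Otherwise walks from y and y' to z avoiding x would close up a cycle
   through x. *)
Lemma tree_unique_closer x y y' z : acyclic_graph e -> irreflexive e ->
  e x y -> e x y' -> y != y' ->
  dist y z <= dist x z -> dist x z < dist y' z.
Proof.
move=> acyc e_irr exy exy' ne_y le_y; rewrite ltnNge; apply/negP=> le_y'.
pose e1 : rel T := fun a b => [&& a != x, b != x & e a b].
have e1_sym : symmetric e1 by move=> a b; rewrite /e1 e_sym andbCA.
have avoid w : e x w -> dist w z <= dist x z -> connect e1 w z.
  move=> exw le_w; have [p [ep lp sp]] := gdist_path w z.
  (* If the shortest walk from [w] met [x], its remainder would reach [z] from [x] in fewer than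
     [dist w z <= dist x z] steps. *)
  have xp : x \notin w :: p.
    apply/negP; rewrite inE => /orP[/eqP xw|/splitPr x_p].
      by rewrite xw e_irr in exw.
    case: x_p ep lp sp => p1 p2; rewrite cat_path last_cat /= => /and3P[_ _ ep2] lp2.
    rewrite size_cat /=; have := gdist_le_size ep2; rewrite lp2; lia.
  apply/connectP; exists p => //.
  elim: p w xp ep {le_w lp sp exw} => //= b p IHp w.
  rewrite !inE !negb_or => /and3P[xw xb xp] /andP[ewb ep].
  by rewrite /e1 eq_sym xw eq_sym xb ewb IHp // inE negb_or xb.
have : connect e1 y y'.
  by rewrite (connect_trans (avoid y exy le_y)) // (sym_connect_sym e1_sym) avoid.
case/connectP=> p0 ep0 defy'; case/shortenP: ep0 defy' => p ep Up _ defy'.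
have p_gt0 : 0 < size p by case: p defy' {ep Up} ne_y => //= <-; rewrite eqxx.
have [xp ep'] : x \notin y :: p /\ path e y p.
  have y_neq_x : y != x by apply: contraTneq exy => ->; rewrite e_irr.
  rewrite inE negb_or eq_sym y_neq_x /= => {Up defy' p_gt0 le_y exy ne_y}.
  elim: p y y_neq_x ep => //= b p IHp w w_x /andP[/and3P[_ bx ewb] ep].
  by rewrite inE negb_or eq_sym bx ewb; apply: IHp bx ep.
have := acyc (x :: y :: p); rewrite /ucycle /= rcons_path exy ep' -defy' e_sym exy' xp.
by move=> /(_ Up); case: (p) p_gt0.
Qed.
End Distance.

(** * Projection of a vertex onto a geodesic *)

Section Geodesic.

Variables (T : finType) (e : rel T) (d : nat) (v : nat -> T).
Hypotheses (e_tree : is_tree e).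
Local Notation dist := (gdist e).
Hypotheses (ev : forall i, i < d -> e (v i) (v i.+1)).
Hypotheses (dv : forall i j, i <= d -> j <= d ->
  dist (v i) (v j) = (i - j) + (j - i)).

(* A walk without backtracking which starts by moving away from u keeps
   moving away from u. *)
Lemma gdist_nonbacktracking (w : nat -> T) m u :
    (forall i, i < m -> e (w i) (w i.+1)) ->
    (forall i, i.+1 < m -> w i != w i.+2) ->
    (0 < m -> dist (w 0) u < dist (w 1) u) ->
  forall i, i <= m -> dist (w i) u = dist (w 0) u + i.
Proof.
have [[e_sym e_irr] e_conn acyc] := e_tree.
move=> ew w2 w01.
(* Inductively [w i] is the neighbour of [w i.+1] closer to [u]; it differs from [w i.+2], which is
   therefore farther. *)
have step i : i < m -> dist (w i) u < dist (w i.+1) u.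
  elim: i => // i IHi lt_i; have lt_i' := ltnW lt_i.
  apply: (tree_unique_closer e_sym e_conn acyc e_irr (y := w i)); rewrite ?ew ?w2 //.
    by rewrite e_sym ew.
  by rewrite ltnW ?IHi.
elim=> [|i IHi] lt_i; first by rewrite addn0.
have := step i lt_i; have := gdist_triangle e_conn (w i) (w i.+1) u.
have := gdist_edge_le (ew i lt_i); rewrite gdist_sym //.
have := IHi (ltnW lt_i); lia.
Qed.

(** Take [v p] nearest to [u]. Following the path from [v p] in either direction is a walk without
    backtracking whose first step cannot approach [u], so each step adds one to the distance. *)
Lemma gdist_projection u : exists p, p <= d /\
  forall i, i <= d -> dist u (v i) = dist u (v p) + ((i - p) + (p - i)).
Proof.
have [[e_sym e_irr] e_conn acyc] := e_tree.
case: (@arg_minnP _ (ord0 : 'I_d.+1) xpredT (fun i => dist u (v i)) isT) => p0 _ pmin.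
have {pmin} pmin i : i <= d -> dist u (v p0) <= dist u (v i).
  by rewrite -ltnS => lt_i; apply: (pmin (Ordinal lt_i)).
case: p0 pmin => p /=; rewrite ltnS => le_p pmin; exists p; split=> // i le_i.
have away (w : nat -> T) m : w 0 = v p ->
    (forall i, i <= m -> exists2 j, j <= d & w i = v j) ->
    (forall i, i < m -> e (w i) (w i.+1)) ->
    (forall i, i.+1 < m -> w i != w i.+2) ->
  forall i, i <= m -> dist (w i) u = dist u (v p) + i.
  move=> w0 wv ew w2 k le_k; rewrite [dist u _]gdist_sym // -w0.
  apply: gdist_nonbacktracking le_k => // m_gt0.
  have [j le_j w1] := wv _ m_gt0.
  have [w0u|ne_u] := eqVneq (w 0) u.
    rewrite {1}w0u gdist0 lt0n gdist_eq0 //.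
    by apply: contraTneq (ew 0 m_gt0) => ->; rewrite w0u e_irr.
  (* The neighbour [y] of [w 0] towards [u] is not [w 1], by minimality of [p]; hence [w 1] is
     strictly farther. *)
  have [y ey dy] := gdist_step e_conn ne_u.
  have le_w : dist (w 0) u <= dist (w 1) u.
    by rewrite w0 w1 ![dist _ u]gdist_sym // pmin.
  apply: (tree_unique_closer e_sym e_conn acyc e_irr ey (ew 0 m_gt0)); last by rewrite dy.
  by apply: contraTneq le_w => <-; rewrite -ltnNge dy.
have ne_v j k : j <= d -> k <= d -> j != k -> v j != v k.
  by move=> le_j le_k ne_jk; rewrite -(gdist_eq0 e_conn) dv //; lia.
have [le_pi|/ltnW le_ip] := leqP p i.
  have := away (fun k => v (p + k)) (d - p) _ _ _ _ (i - p).
  rewrite subnKC // addn0 gdist_sym // => -> //; try lia.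
  - by move=> k le_k; exists (p + k) => //; lia.
  - by move=> k lt_k; rewrite addnS ev //; lia.
  by move=> k lt_k; rewrite ne_v //; lia.
have := away (fun k => v (p - k)) p _ _ _ _ (p - i).
rewrite subKn // subn0 gdist_sym // => -> //; try lia.
- by move=> k le_k; exists (p - k) => //; lia.
- move=> k lt_k; have -> : p - k = (p - k.+1).+1 by lia.
  by rewrite e_sym ev //; lia.
by move=> k lt_k; rewrite ne_v //; lia.
Qed.

End Geodesic.

(** * The Wiener index along a diametral path *)

(** Doubling, and adding the product on the left, avoids division and a subtraction of the
    product. *)
Lemma sum_absdiff d p : p <= d ->
  2 * (\sum_(0 <= i < d.+1) ((i - p) + (p - i))) + 2 * (p * (d - p)) = d * d.+1.
Proof.
elim: p => [|p IHp] le_p.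
  rewrite mul0n addn0; elim: d {le_p} => [|d IHd]; first by rewrite big_nat1.
  by rewrite big_nat_recr //= mulnDr IHd; lia.
have := IHp (ltnW le_p).
(* Moving from [p] to [p.+1] adds one to the distance from each of the [p.+1] positions up to [p]
   and takes one off the other [d - p]. *)
suff : \sum_(0 <= i < d.+1) ((i - p) + (p - i)) + p.+1 =
   \sum_(0 <= i < d.+1) ((i - p.+1) + (p.+1 - i)) + (d - p) by nia.
elim: d le_p {IHp} => // d IHd; rewrite ltnS leq_eqVlt => /orP[/eqP->|lt_p].
  rewrite !(big_nat_recr d.+1) //=.
  suff -> : \sum_(0 <= i < d.+1) ((i - d.+1) + (d.+1 - i)) =
      \sum_(0 <= i < d.+1) ((i - d) + (d - i)) + d.+1 by lia.
  rewrite [X in _ + X](_ : _ = \sum_(0 <= i < d.+1) 1); last first.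
    by rewrite sum_nat_const_nat subn0 muln1.
  by rewrite -big_split; apply: eq_big_nat => i /andP[_ lt_i]; rewrite /=; lia.
by rewrite !(big_nat_recr d.+1) //=; have := IHd lt_p; lia.
Qed.

Lemma wiener_double (T : finType) (e : rel T) : is_tree e ->
  2 * wiener e = \sum_(x : T) \sum_(y : T) gdist e x y.
Proof.
case=> [[e_sym _] e_conn _]; pose r := @enum_rank T.
have split_row (x : T) : \sum_(y : T) gdist e x y =
    \sum_(y | r x < r y) gdist e x y + \sum_(y | r y < r x) gdist e x y.
  rewrite (bigID (fun y => r x < r y)) /=; congr (_ + _).
  rewrite (bigID (fun y => r y < r x)) /= [X in _ + X]big1 ?addn0.
    by apply: eq_bigl => y; case: ltngtP.
  move=> y; rewrite -!leqNgt -eqn_leq => /eqP/val_inj/enum_rank_inj->.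
  by rewrite gdist0.
rewrite (eq_bigr _ (fun x _ => split_row x)) big_split /= mul2n -addnn.
congr (_ + _); rewrite /wiener (exchange_big_dep xpredT) //=.
by apply: eq_bigr => y _; apply: eq_bigr => x _; rewrite gdist_sym.
Qed.

Section Sum.

Variables (T : finType) (e : rel T) (d : nat) (v : nat -> T) (a b c : T).
Hypotheses (e_tree : is_tree e) (cardT : #|T| = d + 4).
Local Notation dist := (gdist e).
Hypotheses (dv : forall i j, i <= d -> j <= d ->
  dist (v i) (v j) = (i - j) + (j - i)).
Hypothesis uniq_vabc : uniq (map v (iota 0 d.+1) ++ [:: a; b; c]).

Lemma big_vabc (F : T -> nat) :
  \sum_(x : T) F x = \sum_(0 <= i < d.+1) F (v i) + (F a + F b + F c).
Proof.
have := uniq_vabc; set s := _ ++ _ => Us.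
have mem_s x : x \in s.
  have : size s = #|T| by rewrite size_cat size_map size_iota cardT addSn addnS.
  move/card_uniqP: (Us) => <- eq_card.
  by have := (subset_cardP eq_card (subset_predT _)) x; rewrite inE.
rewrite -big_enum /= (perm_big s); last first.
  by apply: uniq_perm; rewrite ?enum_uniq // => x; rewrite mem_s mem_enum.
by rewrite big_cat big_map /index_iota subn0 !big_cons big_nil /=; lia.
Qed.

(* u hangs at height h above position p of the path v. *)
Definition has_profile (u : T) p h :=
  forall i, i <= d -> dist u (v i) = h + ((i - p) + (p - i)).

Lemma sum_profile u p h : p <= d -> has_profile u p h ->
  2 * (\sum_(0 <= i < d.+1) dist u (v i)) + 2 * (p * (d - p)) =
  d * d.+1 + 2 * (d.+1 * h).
Proof.
move=> le_p pu; rewrite -(sum_absdiff le_p).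
rewrite [X in 2 * X](_ : _ = \sum_(0 <= i < d.+1) (h + ((i - p) + (p - i)))).
  by rewrite big_split sum_nat_const_nat subn0 /=; lia.
by apply: eq_big_nat => i /andP[_ lt_i]; apply: pu.
Qed.

(** The double sum splits into pairs on the path, pairs of a path vertex with [a], [b] or [c],
    evaluated by [sum_profile], and pairs among these three. Negative terms are moved to the
    left. *)
Lemma wiener_profile pa ha pb hb pc hc :
  pa <= d -> pb <= d -> pc <= d ->
  has_profile a pa ha -> has_profile b pb hb -> has_profile c pc hc ->
  2 * wiener e + 2 * (pa * (d - pa) + pb * (d - pb) + pc * (d - pc)) =
  \sum_(0 <= i < d.+1) \sum_(0 <= j < d.+1) ((i - j) + (j - i)) + 3 * (d * d.+1)
  + 2 * (d.+1 * ha + d.+1 * hb + d.+1 * hc)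
  + 2 * (dist a b + dist a c + dist b c).
Proof.
have [[e_sym _] e_conn _] := e_tree.
move=> le_pa le_pb le_pc fa fb fc; rewrite wiener_double // big_vabc !big_vabc.
have := sum_profile le_pa fa; have := sum_profile le_pb fb.
have := sum_profile le_pc fc.
rewrite (eq_bigr _ (fun i _ => big_vabc (gdist e (v i)))) !big_split /=.
have row x : \sum_(0 <= i < d.+1) dist (v i) x = \sum_(0 <= i < d.+1) dist x (v i).
  by apply: eq_bigr => i _; rewrite gdist_sym.
rewrite !row !gdist0 (gdist_sym e_sym e_conn b a) !(gdist_sym e_sym e_conn c).
have -> : \sum_(0 <= i < d.+1) \sum_(0 <= j < d.+1) dist (v i) (v j) =
    \sum_(0 <= i < d.+1) \sum_(0 <= j < d.+1) ((i - j) + (j - i)).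
  by apply: eq_big_nat => i /andP[_ lt_i]; apply: eq_big_nat => j /andP[_ lt_j];
     rewrite dv.
lia.
Qed.

End Sum.

(** * Optimisation over heights and positions *)

Lemma concave_bound d h p : 0 < h <= p -> h + p <= d -> h * (d - h) <= p * (d - p).
Proof. nia. Qed.

(** The equality case of [concave_bound] at height 1. *)
Lemma concave_bound_eq d p : 0 < p < d -> p * (d - p) = d - 1 -> p = 1 \/ p = d - 1.
Proof. nia. Qed.

(* Here ha, hb, hc are the heights, pa, pb, pc the positions and ab, ac, bc the
   mutual distances of the three vertices off the path. *)
Lemma profile_bound d pa ha pb hb pc hc ab ac bc :
    4 < d ->
    0 < ha <= pa -> 0 < hb <= pb -> 0 < hc <= pc ->
    ha + pa <= d -> hb + pb <= d -> hc + pc <= d ->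
    (1 < ha ->
       (hb.+1 = ha /\ pb = pa /\ ab = 1) \/
       (hc.+1 = ha /\ pc = pa /\ ac = 1)) ->
    (1 < hb ->
       (ha.+1 = hb /\ pa = pb /\ ab = 1) \/
       (hc.+1 = hb /\ pc = pb /\ bc = 1)) ->
    (1 < hc ->
       (ha.+1 = hc /\ pa = pc /\ ac = 1) \/
       (hb.+1 = hc /\ pb = pc /\ bc = 1)) ->
    ab <= ha + hb + ((pa - pb) + (pb - pa)) ->
    ac <= ha + hc + ((pa - pc) + (pc - pa)) ->
    bc <= hb + hc + ((pb - pc) + (pc - pb)) ->
    ab <= ac + bc -> ac <= ab + bc -> bc <= ab + ac ->
  let lhs := d.+1 * ha + d.+1 * hb + d.+1 * hc + (ab + ac + bc) + 3 * d in
  let rhs := pa * (d - pa) + pb * (d - pb) + pc * (d - pc) + 5 * d + 8 in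
  lhs <= rhs /\
  (lhs = rhs -> 5 < d ->
    [/\ ha = 1, hb = 1 & hc = 1] /\
    [/\ ab = 2 + ((pa - pb) + (pb - pa)), ac = 2 + ((pa - pc) + (pc - pa))
      & bc = 2 + ((pb - pc) + (pc - pb))] /\
    [\/ [/\ pa = 1, pb = d - 1 & pc = d - 1], [/\ pb = 1, pa = d - 1 & pc = d - 1],
        [/\ pc = 1, pa = d - 1 & pb = d - 1] |
     [\/ [/\ pa = d - 1, pb = 1 & pc = 1], [/\ pb = d - 1, pa = 1 & pc = 1] |
        [/\ pc = d - 1, pa = 1 & pb = 1]]]).
Proof.
move=> d_gt4 ra rb rc had hbd hcd.
have ca := concave_bound ra had; have cb := concave_bound rb hbd.
have cc := concave_bound rc hcd.
(* The constants make both sides equal to [8 * d + 5] in the configuration of [A_n]: heights 1 and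
   positions 1, [d - 1], [d - 1]. *)
move=> Pa Pb Pc ab_le ac_le bc_le t1 t2 t3 lhs rhs; rewrite /lhs /rhs {lhs rhs}.
have ea := @concave_bound_eq d pa; have eb := @concave_bound_eq d pb.
have ec := @concave_bound_eq d pc.
have qab : pa = pb -> pa * (d - pa) = pb * (d - pb) by move->.
have qac : pa = pc -> pa * (d - pa) = pc * (d - pc) by move->.
have qbc : pb = pc -> pb * (d - pb) = pc * (d - pc) by move->.
(* With these facts recorded, the products in the positions can become variables, which keeps the
   arithmetic linear. *)
move: ca cb cc ea eb ec qab qac qbc.
move: (pa * (d - pa)) (pb * (d - pb)) (pc * (d - pc)) => qa qb qc.
have {}Pa : ha = 1 \/
    ((hb.+1 = ha /\ pb = pa /\ ab = 1) \/
     (hc.+1 = ha /\ pc = pa /\ ac = 1)).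
  by case: (ltnP 1 ha) => [/Pa|]; [right | left; lia].
have {}Pb : hb = 1 \/
    ((ha.+1 = hb /\ pa = pb /\ ab = 1) \/
     (hc.+1 = hb /\ pc = pb /\ bc = 1)).
  by case: (ltnP 1 hb) => [/Pb|]; [right | left; lia].
have {}Pc : hc = 1 \/
    ((ha.+1 = hc /\ pa = pc /\ ac = 1) \/
     (hb.+1 = hc /\ pb = pc /\ bc = 1)).
  by case: (ltnP 1 hc) => [/Pc|]; [right | left; lia].
(* Each height is 1 or one more than another. Circular dependencies are contradictory; otherwise
   every height becomes a numeral, at most 3. *)
case: Pa => [ha1|[[Ea [pE abE]]|[Ea [pE abE]]]];
case: Pb => [hb1|[[Eb [pE' abE']]|[Eb [pE' abE']]]];
case: Pc => [hc1|[[Ec [pE'' abE'']]|[Ec [pE'' abE'']]]]; subst; try (exfalso; lia).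
all: move=> ca cb cc ea eb ec qab qac qbc.
(* A height above 1 makes the bound strict once [d > 5]; at [d = 5] the tree [B_9] attains it. Only
   the case of three heights 1 remains. *)
all: try (clear ea eb ec; split; [lia | move=> ? ?; exfalso; lia]).
split; first lia.
move=> E d_gt5.
(* The position differences sum to twice the spread, at most [2 * (d - 2)], and each product is at
   least [d - 1]. Equality forces all of these bounds, so both ends 1 and [d - 1] occur. *)
have {}ea : pa = 1 \/ pa = d - 1 by apply: ea; lia.
have {}eb : pb = 1 \/ pb = d - 1 by apply: eb; lia.
have {}ec : pc = 1 \/ pc = d - 1 by apply: ec; lia.
split; first by [].
split; first by split; lia.
case: ea => Ea; case: eb => Eb; case: ec => Ec; subst; try (exfalso; lia).
all: first [by constructor 1 | by constructor 2 | by constructor 3 | constructor 4].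
all: first [by constructor 1 | by constructor 2 | by constructor 3].
Qed.

(** * Trees with the distances of A_n *)

(* Twice the Wiener index of A_(d+4); the double sum is over the path. *)
Definition dbl_wienerA d :=
  \sum_(0 <= i < d.+1) \sum_(0 <= j < d.+1) ((i - j) + (j - i)) + 3 * (d * d.+1)
  + 4 * d + 16.

(* The position on the path of A_(d+4) above which label k hangs. *)
Definition footA d k : nat := if k <= d then k else if k == d.+1 then 1 else d - 1.

(** The booleans [d < i] and [d < j] serve as heights. The diagonal is separate because the general
    formula would give 2 for a label off the path. *)
Definition distA d (i j : nat) : nat :=
  if i == j then 0
  else (d < i) + (d < j) + ((footA d i - footA d j) + (footA d j - footA d i)).

Section AShaped.

Variables (T : finType) (e : rel T) (d : nat).
Hypotheses (e_tree : is_tree e) (cardT : #|T| = d + 4) (d_gt4 : 4 < d).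
Local Notation dist := (gdist e).

Definition A_shaped (v : nat -> T) (a b c : T) :=
  [/\ forall i j, i <= d -> j <= d -> dist (v i) (v j) = (i - j) + (j - i),
      [/\ has_profile e d v a 1 1, has_profile e d v b (d - 1) 1
        & has_profile e d v c (d - 1) 1]
    & [/\ dist a b = d, dist a c = d & dist b c = 2]].

(** Applied to [A_n] itself, this evaluation of [wiener_profile] identifies the extremal value. *)
Lemma A_shaped_wiener v a b c : A_shaped v a b c -> 2 * wiener e = dbl_wienerA d.
Proof.
have [[e_sym e_irr] e_conn acyc] := e_tree.
case=> dv [pa pb pc] [dab dac dbc].
have Us : uniq (map v (iota 0 d.+1) ++ [:: a; b; c]).
  have notin u p : p <= d -> has_profile e d v u p 1 -> u \notin map v (iota 0 d.+1).
    move=> le_p pu; apply/mapP=> -[i]; rewrite mem_iota /= => lt_i uv.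
    have := pu i; rewrite -uv gdist0; lia.
  rewrite cat_uniq; apply/and3P; split.
  - rewrite map_inj_in_uniq ?iota_uniq // => i j.
    rewrite !mem_iota /= => lt_i lt_j eq_v.
    by have := dv i j; rewrite eq_v gdist0; lia.
  - apply/hasPn=> u; rewrite !inE => /or3P[]/eqP->.
    + by apply: notin pa; lia.
    + by apply: notin pb; lia.
    by apply: notin pc; lia.
  by rewrite /= !inE negb_or -!(gdist_eq0 e_conn) dab dac dbc; lia.
have le1 : 1 <= d by lia.
have le2 : d - 1 <= d by lia.
have := wiener_profile e_tree cardT dv Us le1 le2 le2 pa pb pc.
rewrite dab dac dbc /dbl_wienerA.
move: (\sum_(0 <= i < d.+1) _) => Q.
have -> : d - (d - 1) = 1 by lia.
by move: (d * d.+1) => E; lia.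
Qed.

Lemma A_shaped_distA v a b c : A_shaped v a b c ->
  exists F : 'I_(d + 4) -> T, forall i j, dist (F i) (F j) = distA d i j.
Proof.
have [[e_sym e_irr] e_conn acyc] := e_tree.
case=> dv [pa pb pc] [dab dac dbc].
pose F (i : 'I_(d + 4)) := if i <= d then v i else
   if i == d.+1 :> nat then a else if i == d.+2 :> nat then b else c.
have FP (i : 'I_(d + 4)) : [\/ i <= d /\ F i = v i, i = d.+1 :> nat /\ F i = a,
    i = d.+2 :> nat /\ F i = b | i = d.+3 :> nat /\ F i = c].
  have lt_i := ltn_ord i; rewrite /F.
  case: leqP => [le_i|lt_di]; first by constructor 1.
  case: eqP => [->|ne1]; first by constructor 2.
  case: eqP => [->|ne2]; first by constructor 3.
  by constructor 4; split=> //; lia.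
have sy := gdist_sym e_sym e_conn.
exists F => i j; case: (FP i) => [] [Hi ->]; case: (FP j) => [] [Hj ->];
  rewrite /distA /footA ?Hi ?Hj ?eqxx ?gdist0 ?dab ?dac ?dbc ?[dist b a]sy ?[dist c a]sy
    ?[dist c b]sy ?dab ?dac ?dbc ?dv ?(sy (v i)) ?pa ?pb ?pc //;
  clear FP sy dab dac dbc dv pa pb pc; repeat case: ifP => ?; lia.
Qed.

End AShaped.

(** * The upper bound and its equality case *)

Lemma gdist_le_diameter (T : finType) (e : rel T) x y : gdist e x y <= diameter e.
Proof.
rewrite /diameter.
apply: leq_trans (leq_bigmax (F := fun x => \max_(y : T) gdist e x y) x).
exact: (leq_bigmax (F := gdist e x)).
Qed.

(** Evaluating each profile at the foot of the other gives [h = h' + |p - p'|] and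
    [h' = h + |p - p'|]. *)
Lemma has_profile_inj (T : finType) (e : rel T) d v u p h p' h' :
  p <= d -> p' <= d -> has_profile e d v u p h -> has_profile e d v u p' h' ->
  p = p' /\ h = h'.
Proof.
move=> le_p le_p' up up'; have := up p le_p; rewrite up' //.
have := up p' le_p'; rewrite up' //; lia.
Qed.

Lemma has_profile_rev (T : finType) (e : rel T) d v u p q h :
  p + q = d -> has_profile e d v u p h -> has_profile e d (fun i => v (d - i)) u q h.
Proof. by move=> eq_d up i le_i; rewrite up ?leq_subr //; lia. Qed.

(** Both ends of the path are within [d] of [u], which bounds [h]. The vertex [w] is the first one
    on a shortest walk from [u] to its foot. *)
Lemma profile_exists (T : finType) (e : rel T) d (v : nat -> T) u :
    is_tree e -> diameter e = d ->
    (forall i, i < d -> e (v i) (v i.+1)) ->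
    (forall i j, i <= d -> j <= d -> gdist e (v i) (v j) = (i - j) + (j - i)) ->
    u \notin map v (iota 0 d.+1) ->
  exists p h, [/\ 0 < h <= p, h + p <= d, has_profile e d v u p h
    & 1 < h -> exists w, [/\ gdist e u w = 1, w \notin map v (iota 0 d.+1)
       & has_profile e d v w p h.-1]].
Proof.
move=> e_tree diam ev dv u_v; have [[e_sym e_irr] e_conn acyc] := e_tree.
have [p [le_p up]] := gdist_projection e_tree ev dv u.
have v_in i : i <= d -> v i \in map v (iota 0 d.+1).
  by move=> le_i; apply/map_f; rewrite mem_iota.
have ne_u : u != v p by apply: contraNneq u_v => ->; apply: v_in.
have h_gt0 : 0 < gdist e u (v p) by rewrite lt0n gdist_eq0.
exists p, (gdist e u (v p)); split=> //.
- have := gdist_le_diameter e u (v d); rewrite up // diam; lia.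
- have := gdist_le_diameter e u (v 0); rewrite up // diam; lia.
move=> h_gt1; have [w euw dw] := gdist_step e_conn ne_u.
have [q [le_q wq]] := gdist_projection e_tree ev dv w.
have du1 : gdist e u w = 1 by apply/eqP; rewrite -edge_gdist.
(* If [w] projected elsewhere, the route through [w] would bring [u] to [v q] in fewer steps than
   its profile allows. *)
have eq_pq : q = p.
  have := wq p le_p; have := up q le_q.
  have := gdist_triangle e_conn w u (v q); lia.
exists w; split=> //.
  apply/mapP=> -[i]; rewrite mem_iota /= => lt_i wv.
  by have := wq i lt_i; rewrite wv gdist0 -wv eq_pq; lia.
by move=> i le_i; rewrite wq // eq_pq dw.
Qed.

Lemma off_path_vertices (T : finType) (d : nat) (v : nat -> T) :
    #|T| = d + 4 -> {in gtn d.+1 &, injective v} ->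
  exists a b c, uniq (map v (iota 0 d.+1) ++ [:: a; b; c]) /\
    forall u, u \notin map v (iota 0 d.+1) -> u \in [:: a; b; c].
Proof.
move=> cardT v_inj; set s := map v _.
have Us : uniq s.
  by rewrite map_inj_in_uniq ?iota_uniq // => i j; rewrite !mem_iota; apply: v_inj.
pose r := [seq u <- enum T | u \notin s].
have Usr : uniq (s ++ r).
  rewrite cat_uniq Us filter_uniq ?enum_uniq // andbT.
  by apply/hasPn=> u; rewrite mem_filter => /andP[].
have r_size : size r = 3.
  have : size (s ++ r) = #|T|.
    rewrite cardE; apply: perm_size; apply: uniq_perm; rewrite ?enum_uniq // => u.
    by rewrite mem_cat mem_filter mem_enum andbT orbN.
  rewrite size_cat size_map size_iota cardT => sz.
  by apply: (@addnI d.+1); rewrite sz; lia.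
have r_mem u : u \notin s -> u \in r by move=> us; rewrite mem_filter us mem_enum.
by case: r r_size Usr r_mem => [|a [|b [|c []]]] // _ Usr r_mem; exists a, b, c.
Qed.

(** The profiles of the three vertices off a diametral path feed [profile_bound], and
    [wiener_profile] turns its conclusion into one about the index. *)
Lemma wiener_tree_le (T : finType) (e : rel T) d :
    is_tree e -> #|T| = d + 4 -> diameter e = d -> 4 < d ->
  2 * wiener e <= dbl_wienerA d /\
  (2 * wiener e = dbl_wienerA d -> 5 < d -> exists v a b c, A_shaped e d v a b c).
Proof.
move=> e_tree cardT diam d_gt4; have [[e_sym e_irr] e_conn acyc] := e_tree.
have [v [ev dv]] : exists v : nat -> T, [/\ forall i, i < d -> e (v i) (v i.+1)
    & forall i j, i <= d -> j <= d -> gdist e (v i) (v j) = (i - j) + (j - i)].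
  rewrite -diam; apply: diameter_geodesic => //; rewrite cardT; lia.
have v_inj : {in gtn d.+1 &, injective v}.
  move=> i j; rewrite !inE !ltnS => le_i le_j eq_v.
  by have := dv i j le_i le_j; rewrite eq_v gdist0; lia.
have [a [b [c [Us off]]]] := off_path_vertices cardT v_inj.
have [a_v b_v c_v] : [/\ a \notin map v (iota 0 d.+1), b \notin map v (iota 0 d.+1)
    & c \notin map v (iota 0 d.+1)].
  move: Us; rewrite cat_uniq => /and3P[_ /hasPn out _].
  by split; apply: out; rewrite !inE eqxx ?orbT.
have [pa [ha [ra ra' fa na]]] := profile_exists e_tree diam ev dv a_v.
have [pb [hb [rb rb' fb nb]]] := profile_exists e_tree diam ev dv b_v.
have [pc [hc [rc rc' fc nc]]] := profile_exists e_tree diam ev dv c_v.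
have le_pa : pa <= d by lia.
have le_pb : pb <= d by lia.
have le_pc : pc <= d by lia.
have sy := gdist_sym e_sym e_conn.
have pair x y p h q k : p <= d -> q <= d -> has_profile e d v x p h ->
    has_profile e d v y q k -> gdist e x y <= h + k + ((p - q) + (q - p)).
  move=> le_p le_q xp yq; have := gdist_triangle e_conn (v p) x y.
  by rewrite xp // (sy (v p)) yq //; lia.
have parent x p h y q k z r l : p <= d -> q <= d -> r <= d ->
    (1 < h -> exists w, [/\ gdist e x w = 1, w \notin map v (iota 0 d.+1)
       & has_profile e d v w p h.-1]) ->
    (forall u, u \notin map v (iota 0 d.+1) -> u \in [:: x; y; z]) ->
    has_profile e d v y q k -> has_profile e d v z r l -> 1 < h ->
    (k.+1 = h /\ q = p /\ gdist e x y = 1) \/ (l.+1 = h /\ r = p /\ gdist e x z = 1).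
  move=> le_p le_q le_r nx xyz yq zr h_gt1; have [w [dw w_v wp]] := nx h_gt1.
  (* The lower neighbour of [x] is off the path, so it is [y] or [z], and uniqueness of profiles
     fixes its position and height. *)
  have := xyz w w_v; rewrite !inE => /or3P[] /eqP Ew; subst w.
  - by rewrite gdist0 in dw.
  - by left; have [] := has_profile_inj le_q le_p yq wp; lia.
  - by right; have [] := has_profile_inj le_r le_p zr wp; lia.
have off_b u : u \notin map v (iota 0 d.+1) -> u \in [:: b; a; c].
  by move/off; rewrite !inE orbCA.
have off_c u : u \notin map v (iota 0 d.+1) -> u \in [:: c; a; b].
  by move/off; rewrite !inE orbA orbC.
have Na := parent _ _ _ _ _ _ _ _ _ le_pa le_pb le_pc na off fb fc.
have Nb := parent _ _ _ _ _ _ _ _ _ le_pb le_pa le_pc nb off_b fa fc.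
have Nc := parent _ _ _ _ _ _ _ _ _ le_pc le_pa le_pb nc off_c fa fb.
rewrite (sy b a) in Nb; rewrite (sy c a) (sy c b) in Nc.
have [] := profile_bound d_gt4 ra rb rc ra' rb' rc' Na Nb Nc
  (pair _ _ _ _ _ _ le_pa le_pb fa fb) (pair _ _ _ _ _ _ le_pa le_pc fa fc)
  (pair _ _ _ _ _ _ le_pb le_pc fb fc).
- by have := gdist_triangle e_conn c a b; rewrite (sy c b).
- exact: gdist_triangle.
- by have := gdist_triangle e_conn a b c; rewrite (sy b a).
have := wiener_profile e_tree cardT dv Us le_pa le_pb le_pc fa fb fc.
rewrite /dbl_wienerA.
set X := pa * _ + _ + _; set Y := d.+1 * ha + _ + _; set Z := gdist e a b + _ + _.
set Q := \sum_(0 <= i < d.+1) _; set E := 3 * _ => sumE le_bound eq_bound.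
split; first by lia.
move=> max_e d_gt5.
have [|[ha1 hb1 hc1] [[dab dac dbc] shape]] := eq_bound _ d_gt5; first by lia.
subst ha hb hc.
have shaped w x y z p q : (forall i j, i <= d -> j <= d ->
      gdist e (w i) (w j) = (i - j) + (j - i)) ->
    p = 1 -> q = d - 1 ->
    has_profile e d w x p 1 -> has_profile e d w y q 1 -> has_profile e d w z q 1 ->
    gdist e x y = d -> gdist e x z = d -> gdist e y z = 2 ->
    exists v a b c, A_shaped e d v a b c.
  by move=> dw -> -> ? ? ? ? ? ?; exists w, x, y, z; split.
(* Reversing the path reduces the three shapes with two vertices at position 1 to those with two at
   [d - 1]. *)
have dv' i j : i <= d -> j <= d ->
    gdist e (v (d - i)) (v (d - j)) = (i - j) + (j - i).
  by move=> le_i le_j; rewrite dv ?leq_subr //; lia.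
clear Na Nb Nc na nb nc sumE max_e eq_bound le_bound X Y Z Q E.
clear parent pair off off_b off_c.
have D1 : (d - 1) + 1 = d by lia.
have D2 : 1 + (d - 1) = d by lia.
have far : 2 + (1 - (d - 1) + (d - 1 - 1)) = d by lia.
have far' : 2 + ((d - 1) - 1 + (1 - (d - 1))) = d by lia.
have near p : 2 + (p - p + (p - p)) = 2 by rewrite subnn.
case: shape => [[]|[]|[]|[[]|[]|[]]] Ea Eb Ec; subst pa pb pc.
- by apply: (shaped v a b c 1 (d - 1)); rewrite ?dab ?dac ?dbc.
- by apply: (shaped v b a c 1 (d - 1)); rewrite ?(sy b a) ?dab ?dac ?dbc.
- by apply: (shaped v c a b 1 (d - 1)); rewrite ?(sy c) ?dab ?dac ?dbc.
- by apply: (shaped (fun i => v (d - i)) a b c 1 (d - 1)) => //;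
    rewrite ?dab ?dac ?dbc //; apply: has_profile_rev; eauto.
- by apply: (shaped (fun i => v (d - i)) b a c 1 (d - 1)) => //;
    rewrite ?(sy b a) ?dab ?dac ?dbc //; apply: has_profile_rev; eauto.
by apply: (shaped (fun i => v (d - i)) c a b 1 (d - 1)) => //;
    rewrite ?(sy c) ?dab ?dac ?dbc //; apply: has_profile_rev; eauto.
Qed.

(** * The distances in A_n and B_9 *)

Section Model.

Variables (T : finType) (e : rel T) (delta : T -> T -> nat).
Hypotheses (delta0 : forall z, delta z z = 0)
  (delta_edge : forall x y z, e x y -> delta x z <= (delta y z).+1)
  (delta_step : forall x z, x != z ->
    exists2 y, e x y & delta x z = (delta y z).+1).

Lemma model_walk x z : exists p, [/\ path e x p, last x p = z & size p = delta x z].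
Proof.
elim: {x}(delta x z) {-2}x (erefl (delta x z)) => [|k IHk] x dx.
  by have [->|/delta_step[y]] := eqVneq x z; [exists [::] | rewrite dx].
have [xz|/delta_step[y exy]] := eqVneq x z; first by rewrite xz delta0 in dx.
rewrite dx => -[/esym dy]; have [p [ep lp sp]] := IHk y dy.
by exists (y :: p); split; rewrite /= ?exy ?sp ?dy.
Qed.

Lemma model_connected : connected_graph e.
Proof.
by move=> x z; have [p [ep <- _]] := model_walk x z; apply/connectP; exists p.
Qed.

(** Descending steps yield a walk of length [delta x z]. No walk is shorter, since [delta] drops by
    at most one along each edge. *)
Lemma model_gdist x z : gdist e x z = delta x z.
Proof.
apply/eqP; rewrite eqn_leq; apply/andP; split.
  by have [p [ep <- <-]] := model_walk x z; apply: gdist_le_size.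
have [p [ep lp <-]] := gdist_path model_connected x z.
elim: p x ep lp => [|y p IHp] x /=; first by move=> _ ->; rewrite delta0.
case/andP=> exy ep lp; apply: leq_trans (delta_edge _ exy) _.
by rewrite ltnS IHp.
Qed.

End Model.

(** The largest vertex of a cycle with at least three vertices would have two distinct smaller
    neighbours. *)
Lemma acyclic_ord n (e : rel 'I_n) : symmetric e ->
    (forall x y y' : 'I_n, y < x -> y' < x -> e x y -> e x y' -> y = y') ->
  acyclic_graph e.
Proof.
move=> e_sym uniq_down c; case: c => [|c0 c] // cyc.
have [m m_c m_max] : exists2 m : 'I_n, m \in c0 :: c &
    forall i, i \in c0 :: c -> i <= m.
  have := @arg_maxnP _ c0 (mem (c0 :: c)) (@nat_of_ord n) (mem_head _ _).
  by case=> m; exists m.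
have [k s def_s] := rot_to m_c; rewrite leqNgt; apply/negP=> c_gt2.
have := cyc; rewrite -(rot_ucycle k) def_s /ucycle => /andP[].
have {}m_max i : i \in m :: s -> i <= m by rewrite -def_s mem_rot; apply: m_max.
have : 2 < size (m :: s) by rewrite -def_s size_rot.
(* The cycle is rotated to start at its maximum [m], so the second entry [y] and the last entry [y']
   are the neighbours of [m]. *)
case: s {def_s} m_max => [|y s] //; case: (lastP s) => // t y' m_max _.
rewrite [cycle _ _]/= !rcons_path last_rcons => /andP[emy /andP[_ ey'm]].
rewrite -!rcons_cons rcons_uniq cons_uniq !in_cons !negb_or.
case/and3P=> /and3P[ne_my' ne_yy' _] /andP[ne_my _] _.
move/eqP: ne_yy'; apply; apply/esym/(uniq_down m) => //; last by rewrite e_sym.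
  by rewrite ltn_neqAle eq_sym ne_my /= m_max // !in_cons eqxx orbT.
by rewrite ltn_neqAle ne_my' /= m_max // !in_cons mem_rcons in_cons eqxx !orbT.
Qed.

Lemma A_treeE d (i j : 'I_(d + 4)) : 4 < d ->
  A_tree (d + 4) i j = (distA d i j == 1).
Proof.
move=> d_gt4; rewrite /A_tree /path_plus !inE !xpair_eqE /distA /footA addnK.
have -> : d + 4 - 3 = d.+1 by lia.
have -> : d + 4 - 2 = d.+2 by lia.
have -> : d + 4 - 1 = d.+3 by lia.
have -> : d + 4 - 5 = d - 1 by lia.
have lt_i := ltn_ord i; have lt_j := ltn_ord j.
have split_label k : k < d + 4 -> [\/ k <= d, k = d.+1, k = d.+2 | k = d.+3].
  move=> lt_k; have [le_k|lt_dk] := leqP k d; first by constructor 1.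
  have : k = d.+1 \/ k = d.+2 \/ k = d.+3 by lia.
  by case=> [|[]]; [constructor 2 | constructor 3 | constructor 4].
move: (nat_of_ord i) (nat_of_ord j) (split_label _ lt_i) (split_label _ lt_j).
move=> {lt_i lt_j split_label}i {}j.
case=> Hi; case=> Hj; rewrite ?Hi ?Hj.
all: by repeat case: ifP => ?; lia.
Qed.

Lemma distA_refl d i : distA d i i = 0.
Proof. by rewrite /distA eqxx. Qed.

Lemma distA_sym d i j : distA d i j = distA d j i.
Proof. by rewrite /distA eq_sym [_ + (d < j)]addnC [X in _ + X]addnC. Qed.

Lemma distA_triangle d i j k : distA d i k <= distA d i j + distA d j k.
Proof.
rewrite /distA.
have [->|ik] := eqVneq i k; first by [].
have [<-|ij] := eqVneq i j; first by rewrite (negPf ik).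
have [->|jk] := eqVneq j k; first by rewrite addn0.
by move: (footA d i) (footA d j) (footA d k); lia.
Qed.

Lemma footAP d k : 4 < d ->
  (k <= d /\ footA d k = k) \/ (d < k /\ 0 < footA d k < d).
Proof. by rewrite /footA => d_gt4; case: leqP => ?; [left | right; case: eqP; lia]. Qed.

(** From a label off the path step to its foot; from a path label step towards the foot of [k], or
    to [k] itself once there. *)
Lemma distA_step d i k : 4 < d -> i < d + 4 -> k < d + 4 -> i != k ->
  exists j, [/\ j < d + 4, distA d i j = 1 & distA d i k = (distA d j k).+1].
Proof.
move=> d_gt4 lt_i lt_k ne_ik.
pose ok j := [/\ j < d + 4, distA d i j = 1 & distA d i k = (distA d j k).+1].
have Fi := footAP i d_gt4; have Fk := footAP k d_gt4.
have [lt_di|le_id] := ltnP d i.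
  exists (footA d i); have := footAP (footA d i) d_gt4; rewrite /distA.
  by move: (footA d (footA d i)) (footA d i) (footA d k) Fi Fk => y x z *;
    split; repeat case: ifP => ?; lia.
have near j : (footA d k = i /\ j = k) \/
    (j = i.+1 /\ i < footA d k) \/ (j.+1 = i /\ footA d k < i) -> ok j.
  move=> j_cases; have := footAP j d_gt4; rewrite /ok /distA.
  have : j = k -> footA d j = footA d k by move->.
  move: (footA d i) (footA d j) (footA d k) Fi Fk j_cases => x y z *.
  by split; repeat case: ifP => ?; lia.
have [lt_if|gt_if|eq_if] := ltngtP i (footA d k).
- by exists i.+1; apply: near; lia.
- by exists i.-1; apply: near; lia.
by exists k; apply: near; left.
Qed.

Lemma distA_down d i j : 4 < d -> j < i -> distA d i j = 1 ->
  j = if i <= d then i.-1 else footA d i.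
Proof.
move=> d_gt4 lt_ji; rewrite /distA gtn_eqF //.
have := footAP i d_gt4; have := footAP j d_gt4.
by move: (footA d i) (footA d j) => x y *; case: (leqP i d); lia.
Qed.

Lemma distA_le d i j : 4 < d -> i < d + 4 -> j < d + 4 -> distA d i j <= d.
Proof. by move=> *; rewrite /distA /footA; repeat case: ifP => ?; lia. Qed.

Section ATree.
Variable (d : nat).
Hypothesis d_gt4 : 4 < d.
Local Notation n := (d + 4).

Lemma A_tree_gdist (i j : 'I_n) :
  connected_graph (A_tree n) /\ gdist (A_tree n) i j = distA d i j.
Proof.
have d0 (z : 'I_n) : distA d z z = 0 by apply: distA_refl.
have dE (x y z : 'I_n) : A_tree n x y -> distA d x z <= (distA d y z).+1.
  by rewrite A_treeE // => /eqP xy; have := distA_triangle d x y z; rewrite xy.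
have dS (x z : 'I_n) : x != z ->
    exists2 y, A_tree n x y & distA d x z = (distA d y z).+1.
  move=> ne_xz; have [y [lt_y xy yz]] := distA_step d_gt4 (ltn_ord x) (ltn_ord z) ne_xz.
  by exists (Ordinal lt_y); rewrite ?A_treeE //= xy.
by split; [apply: (model_connected d0 dS) | apply: (model_gdist d0 dE dS)].
Qed.

Lemma A_tree_is_tree : is_tree (A_tree n).
Proof.
have sy : symmetric (A_tree n) by move=> i j; rewrite !A_treeE // distA_sym.
split; first by split=> // i; rewrite A_treeE // distA_refl.
  have lt0 : 0 < n by lia.
  by have [] := A_tree_gdist (Ordinal lt0) (Ordinal lt0).
apply: acyclic_ord => // x y y' lt_y lt_y'; rewrite !A_treeE // => /eqP xy /eqP xy'.
by apply: val_inj; rewrite /= (distA_down d_gt4 lt_y xy) (distA_down d_gt4 lt_y' xy').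
Qed.

End ATree.

Lemma diameter_eq (T : finType) (e : rel T) d x y :
  (forall x y, gdist e x y <= d) -> gdist e x y = d -> diameter e = d.
Proof.
move=> le_d dxy; apply/eqP; rewrite eqn_leq -{2}dxy gdist_le_diameter andbT.
by apply/bigmax_leqP=> i _; apply/bigmax_leqP=> j _.
Qed.

Lemma A_tree_family d : 4 < d -> in_Tfamily (A_tree (d + 4)) (d + 4) d.
Proof.
move=> d_gt4; have dA i j := (A_tree_gdist d_gt4 i j).2.
split; [exact: card_ord | exact: A_tree_is_tree |].
have lt0 : 0 < d + 4 by lia.
have ltd : d < d + 4 by lia.
apply: (diameter_eq (x := Ordinal lt0) (y := Ordinal ltd)) => [x y|].
  by rewrite dA distA_le.
by rewrite dA /distA /footA /=; repeat case: ifP => ?; lia.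
Qed.

Lemma A_tree_wiener d : 4 < d -> 2 * wiener (A_tree (d + 4)) = dbl_wienerA d.
Proof.
move=> d_gt4; have dA i j := (A_tree_gdist d_gt4 i j).2.
have [cardT e_tree _] := A_tree_family d_gt4.
have lt0 : 0 < d + 4 by lia.
(* The path must be a function on all of [nat]; numbers out of range default to label 0. *)
pose l k : 'I_(d + 4) := insubd (Ordinal lt0) k.
have lE k : k < d + 4 -> l k = k :> nat by move=> lt_k; rewrite val_insubd lt_k.
apply: (A_shaped_wiener e_tree cardT d_gt4 (v := l)
  (a := l d.+1) (b := l d.+2) (c := l d.+3)).
have [E1 E2 E3] : [/\ l d.+1 = d.+1 :> nat, l d.+2 = d.+2 :> nat & l d.+3 = d.+3 :> nat].
  by split; apply: lE; lia.
split; [move=> i j le_i le_j | split=> i le_i | split];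
  rewrite dA ?E1 ?E2 ?E3 ?lE //; try lia;
  by rewrite /distA /footA; repeat case: ifP => ?; lia.
Qed.

(* In B_9, label 6 hangs on 4, label 7 on 2, and label 8 on 7. *)
Definition distB (i j : nat) : nat :=
  let foot k := if k <= 5 then k else if k == 6 then 4 else 2 in
  let height k := if k <= 5 then 0 else if k == 8 then 2 else 1 in
  if i == j then 0 else if minn i j == 7 then 1 else
  height i + height j + ((foot i - foot j) + (foot j - foot i)).

(** This reduces statements about [B_9] to evaluation on numerals. Predicates of two vertices take a
    dummy third argument. *)
Lemma forall_ord9 (P : nat -> nat -> nat -> bool) :
    all (fun i => all (fun j => all (P i j) (iota 0 9)) (iota 0 9)) (iota 0 9) ->
  forall i j k : 'I_9, P i j k.
Proof.
have ord9 (i : 'I_9) : (i : nat) \in iota 0 9 by rewrite mem_iota ltn_ord.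
move=> /allP P9 i j k.
by have /allP/(_ _ (ord9 j))/allP/(_ _ (ord9 k)) := P9 _ (ord9 i).
Qed.

Lemma B_treeE (i j : 'I_9) : B_tree 9 i j = (distB i j == 1).
Proof.
pose arc i j := (j == i.+1) && (j <= 5) || ((i, j) \in [:: (4, 6); (2, 7); (7, 8)]).
apply/eqP; pose P i j (_ : nat) := (arc i j || arc j i) == (distB i j == 1).
by apply: (forall_ord9 (P := P) _ i j ord0); vm_compute.
Qed.

Lemma B_tree_gdist (i j : 'I_9) :
  connected_graph (B_tree 9) /\ gdist (B_tree 9) i j = distB i j.
Proof.
have d0 (z : 'I_9) : distB z z = 0 by rewrite /distB eqxx.
have dE (x y z : 'I_9) : B_tree 9 x y -> distB x z <= (distB y z).+1.
  rewrite B_treeE; apply/implyP.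
  pose P x y z := (distB x y == 1) ==> (distB x z <= (distB y z).+1).
  by apply: (forall_ord9 (P := P)); vm_compute.
have dS (x z : 'I_9) : x != z ->
    exists2 y, B_tree 9 x y & distB x z = (distB y z).+1.
  pose P x z (_ : nat) := (x != z) ==>
      has (fun k => (distB x k == 1) && (distB x z == (distB k z).+1)) (iota 0 9).
  have /implyP step : P x z (ord0 : 'I_9) by apply: forall_ord9; vm_compute.
  move=> /step /hasP[k]; rewrite mem_iota => lt_k /andP[xk /eqP kz].
  by exists (Ordinal lt_k); rewrite ?B_treeE.
by split; [apply: (model_connected d0 dS) | apply: (model_gdist d0 dE dS)].
Qed.

Lemma B_tree_family : in_Tfamily (B_tree 9) 9 5.
Proof.
have dB i j := (B_tree_gdist i j).2.
have sy : symmetric (B_tree 9).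
  move=> i j; rewrite !B_treeE.
  pose P i j (_ : nat) := (distB i j == 1) == (distB j i == 1).
  suff : P i j (ord0 : 'I_9) by move/eqP.
  by apply: forall_ord9; vm_compute.
split; [exact: card_ord | split |].
- by split=> // i; rewrite B_treeE /distB eqxx.
- by have [] := B_tree_gdist ord0 ord0.
- apply: acyclic_ord => // x y y'; rewrite !B_treeE => lt_y lt_y' xy xy'.
  pose P x y y' := (y < x) ==> ((y' < x) ==> ((distB x y == 1) ==>
    ((distB x y' == 1) ==> (y == y')))).
  have : P x y y' by apply: forall_ord9; vm_compute.
  by rewrite /P lt_y lt_y' xy xy' => /eqP/val_inj.
apply: (diameter_eq (x := ord0) (y := inord 5)) => [x y|].
  pose P x y (_ : nat) := distB x y <= 5.
  by rewrite dB; apply: (forall_ord9 (P := P) _ x y ord0); vm_compute.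
by rewrite dB inordK.
Qed.

Lemma B_tree_wiener : 2 * wiener (B_tree 9) = dbl_wienerA 5.
Proof.
have [_ e_tree _] := B_tree_family; have dB i j := (B_tree_gdist i j).2.
rewrite wiener_double //.
(* Sums over ordinals become sums over intervals of naturals, which can be evaluated. *)
rewrite (eq_bigr (fun i : 'I_9 => \sum_(0 <= j < 9) distB i j)); last first.
  by move=> i _; rewrite big_mkord; apply: eq_bigr => j _.
rewrite -(big_mkord xpredT (fun i => \sum_(0 <= j < 9) distB i j)).
by rewrite /dbl_wienerA unlock; vm_compute.
Qed.

(** * Maximality and uniqueness *)

Lemma A_tree_maximizes d : 4 < d -> maximizes_wiener (d + 4) d (A_tree (d + 4)).
Proof.
move=> d_gt4; split=> [|U e' [cardU e'_tree diam]]; first exact: A_tree_family.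
have [+ _] := wiener_tree_le e'_tree cardU diam d_gt4.
by rewrite -(A_tree_wiener d_gt4) leq_pmul2l.
Qed.

(** Comparison with [A_n] forces equality in the bound. The resulting labelling preserves distances,
    so it is injective, hence bijective by cardinality, and it preserves edges as pairs at distance
    1. *)
Lemma maximizer_iso_A_tree d (T : finType) (e : rel T) : 5 < d ->
  maximizes_wiener (d + 4) d e -> graph_iso e (A_tree (d + 4)).
Proof.
move=> d_gt5 [[cardT e_tree diam] e_max]; have d_gt4 := ltnW d_gt5.
have [[_ e_irr] e_conn _] := e_tree.
have [le_W eq_W] := wiener_tree_le e_tree cardT diam d_gt4.
have [|v [a [b [c shaped]]]] := eq_W _ d_gt5.
  apply/eqP; rewrite eqn_leq le_W -(A_tree_wiener d_gt4) leq_pmul2l //.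
  by apply: e_max; apply: A_tree_family.
have [F dF] := A_shaped_distA e_tree cardT d_gt4 shaped.
have F_inj : injective F.
  move=> i j eq_F; apply: val_inj => /=; apply/eqP; move: (dF i j).
  rewrite eq_F gdist0 /distA; case: eqP => // /eqP ne_ij.
  have := footAP i d_gt4; have := footAP j d_gt4.
  by move: (footA d i) (footA d j); lia.
have [|g gK Kg] := inj_card_bij F_inj; first by rewrite cardT card_ord.
exists g; first by exists F.
by move=> x y; rewrite A_treeE // -dF !Kg edge_gdist.
Qed.

Theorem mainTheorem2 :
  [/\ maximizes_wiener 9 5 (A_tree 9),
      maximizes_wiener 9 5 (B_tree 9) &
      wiener (A_tree 9) = wiener (B_tree 9)] /\
  (forall n : nat, 10 <= n ->
     maximizes_wiener n (n - 4) (A_tree n) /\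
     forall (T : finType) (e : rel T),
       maximizes_wiener n (n - 4) e -> graph_iso e (A_tree n)).
Proof.
have A9 : maximizes_wiener 9 5 (A_tree 9) by apply: (@A_tree_maximizes 5).
have eq_W : wiener (A_tree 9) = wiener (B_tree 9).
  by apply/eqP; rewrite -(eqn_pmul2l (m := 2)) // B_tree_wiener (@A_tree_wiener 5).
split; first split=> //.
  (* [B_9] inherits maximality from [A_9] through the equality of their indices. *)
  by split=> [|U e' e'_fam]; [exact: B_tree_family | rewrite -eq_W; apply: A9.2].
move=> n n_ge10; have [d [d_gt5 ->]] : exists d, 5 < d /\ n = d + 4.
  by exists (n - 4); lia.
rewrite addnK; split; first by apply: A_tree_maximizes; apply: ltnW.
by move=> T e; apply: maximizer_iso_A_tree.
Qed.
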